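(* Let $R$ be a commutative ring with unit. Let $(G,w)$ and $(G',w')$ be two weighted digraphs, with non-vanishing weights $w:V\to R$ and $w':V'\to R$. Let $f:(G,w)\longrightarrow (G',w')$ be a morphism of weighted digraphs. Then $f$ induces a homomorphism between the weighted path homologies $$f_*: H_p(G,w;R)\longrightarrow H_p(G',w';R),\qquad p\geq 0.$$
   Context: A digraph $G=(V,E)$ consists of a finite nonempty set $V$ and a set $E$ of ordered pairs $(u,v)\in V\times V$ with $u\ne v$; write $u\to v$ for $(u,v)\in E$. A weight on $G$ is a function $w:V\to R$; it is non-vanishing if $w(i)\neq 0$ for all $i\in V$. The pair $(G,w)$ is a weighted digraph. For $p\ge 0$, $\Lambda_p(V)$ is the free $R$-module on all sequences (elementary $p$-paths) $e_{i_0\cdots i_p}$, $i_k\in V$; $\Lambda_{-1}(V)=R$ (generated by the empty path). An elementary path is regular if $i_k\ne i_{k+1}$ for all $k$, otherwise non-regular. $\mathcal R_p(V)$ and $\mathcal I_p(V)$ are the submodules of $\Lambda_p(V)$ generated by the regular, resp. non-regular, elementary $p$-paths, and $\mathcal R_p(V)\cong\Lambda_p(V)/\mathcal I_p(V)$. The weighted boundary operator is $\partial^w e_{i_0\cdots i_p}=\sum_{q=0}^p(-1)^q w(i_q)\,e_{i_0\cdots\widehat{i_q}\cdots i_p}$, extended linearly; it induces $\partial^w:\mathcal R_p(V)\to\mathcal R_{p-1}(V)$ through this isomorphism (i.e. non-regular terms are set to $0$), with $\partial^w\partial^w=0$. An elementary path $e_{i_0\cdots i_p}$ is allowed on $G$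 if $i_{k-1}\to i_k$ for all $k=1,\dots,p$. $\mathcal A_p(G)\subseteq\mathcal R_p(V)$ is the submodule generated by allowed elementary $p$-paths ($\mathcal A_{-1}(G)=R$). Put $\Omega^w_p(G)=\{v\in\mathcal A_p(G):\partial^w v\in\mathcal A_{p-1}(G)\}$; these form a chain complex under $\partial^w$. The weighted path homology $H_p(G,w;R)$, $p\ge0$, is the $p$-th homology of the truncated complex $\cdots\to\Omega^w_1(G)\to\Omega^w_0(G)\to0$ (the map $\Omega^w_0(G)\to R$ is replaced by $\Omega^w_0(G)\to 0$). A morphism of weighted digraphs $f:(G,w)\to(G',w')$, with $G'=(V',E')$, is a map $f:V\to V'$ such that $i\to j$ in $G$ implies $f(i)\to f(j)$ in $G'$ or $f(i)=f(j)$, and $w(i)=w'(f(i))$ for all $i\in V$. *)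

(* Defs.v *)
From HB Require Import structures.
From mathcomp Require Import all_boot all_algebra generic_quotient ring_quotient.
From mathcomp Require Import boolp.

Set Implicit Arguments.
Unset Strict Implicit.
Unset Printing Implicit Defensive.

Import GRing.Theory.
Local Open Scope ring_scope.

Record digraph := Digraph {
  vertex :> finType;
  edge : rel vertex;
  edge_irr : irreflexive edge;
  vertex_gt0 : (0 < #|vertex|)%N
}.

Definition nonvanishing (R : comPzRingType) (G : digraph) (w : G -> R) : Prop :=
  forall i, w i != 0.

Record wmorphism (R : comPzRingType) (G : digraph) (w : G -> R)
    (G' : digraph) (w' : G' -> R) := WMorphism {
  wmor_fun :> G -> G';
  wmor_edge : forall i j : G,
    edge i j -> edge (wmor_fun i) (wmor_fun j) \/ wmor_fun i = wmor_fun j;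
  wmor_weight : forall i : G, w i = w' (wmor_fun i)
}.

(* [chain R V n] is Lambda_(n-1)(V): the index is the number of vertices of the
   paths, so that [chain R V 0] is Lambda_(-1)(V), free on the empty path. *)
Definition chain (R : comPzRingType) (V : finType) (n : nat) : Type :=
  {ffun n.-tuple V -> R^o}.

HB.instance Definition _ R V n := GRing.Lmodule.on (@chain R V n).

Section Chains.
Variables (R : comPzRingType) (V : finType).

Definition epath n (t : n.-tuple V) : chain R V n := [ffun s => (s == t)%:R].

Section LinearExtension.
Variables (n : nat) (M : lmodType R) (g : n.-tuple V -> M).

Definition lext (v : chain R V n) : M := \sum_t v t *: g t.

Fact lext_is_linear : linear lext.
Proof.
move=> a u v; rewrite /lext scaler_sumr -big_split /=.
by apply: eq_bigr => t _; rewrite !ffunE scalerDl scalerA.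
Qed.

HB.instance Definition _ :=
  GRing.isLinear.Build R (chain R V n) M *:%R lext lext_is_linear.
End LinearExtension.

Definition regular n (t : n.-tuple V) : bool := sorted (fun i j => i != j) t.

(* The projection Lambda -> Lambda/I = R that sets non-regular terms to 0. *)
Definition reg n : chain R V n -> chain R V n :=
  lext (fun t => if regular t then epath t else 0).
HB.instance Definition _ n := GRing.Linear.on (@reg n).

Definition omit n (t : n.+1.-tuple V) (q : 'I_n.+1) : n.-tuple V :=
  [tuple tnth t (lift q k) | k < n].

Definition bdLambda (w : V -> R) n : chain R V n.+1 -> chain R V n :=
  lext (fun t => \sum_(q < n.+1) ((-1) ^+ q * w (tnth t q)) *: epath (omit t q)).
HB.instance Definition _ w n := GRing.Linear.on (@bdLambda w n).

(* The boundary induced on regular paths. *)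
Definition bd (w : V -> R) n (v : chain R V n.+1) : chain R V n :=
  reg (bdLambda w v).

Fact bd_is_linear w n : linear (@bd w n).
Proof. by move=> a u v; rewrite /bd !linearP. Qed.
HB.instance Definition _ w n :=
  GRing.isLinear.Build R (chain R V n.+1) (chain R V n) *:%R (@bd w n)
    (@bd_is_linear w n).

(* The boundary of the truncated complex, whose last map is Omega_0 -> 0. *)
Definition tbd (w : V -> R) (p : nat) : chain R V p.+1 -> chain R V p :=
  if p is 0 then fun=> 0 else bd w (n := p).

Fact tbd_is_linear w p : linear (@tbd w p).
Proof.
case: p => [|p] a u v; last exact: linearP.
by rewrite /tbd scaler0 addr0.
Qed.
HB.instance Definition _ w p :=
  GRing.isLinear.Build R (chain R V p.+1) (chain R V p) *:%R (@tbd w p)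
    (@tbd_is_linear w p).

End Chains.

Arguments reg {R V n}.
Arguments bd {R V} w {n}.
Arguments tbd {R V} w {p}.

(* e_{i_0...i_p} |-> e_{f(i_0)...f(i_p)}, or 0 if the latter is non-regular *)
Definition push (R : comPzRingType) (V V' : finType) (f : V -> V') n :
    chain R V n -> chain R V' n :=
  lext (fun t => reg (epath R (map_tuple f t))).
HB.instance Definition _ R V V' f n := GRing.Linear.on (@push R V V' f n).

Section Homology.
Variables (R : comPzRingType) (G : digraph).

Definition allowed n (t : n.-tuple G) : bool := sorted (@edge G) t.

(* [A n] is A_(n-1)(G), generated by the allowed paths with n vertices. *)
Definition A n : {pred chain R G n} := fun v =>
  `[< exists c : n.-tuple G -> R, v = \sum_(t | allowed t) c t *: epath R t >].

Arguments A : clear implicits.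

Fact A_submod n : submod_closed (A n).
Proof.
split=> [|a u v /asboolP[c ->] /asboolP[c' ->]]; apply/asboolP.
  by exists (fun=> 0); rewrite big1 // => t _; rewrite scale0r.
exists (fun t => a * c t + c' t); rewrite scaler_sumr -big_split /=.
by apply: eq_bigr => t _; rewrite scalerDl scalerA.
Qed.
HB.instance Definition _ n :=
  GRing.isSubmodClosed.Build R (chain R G n) (A n) (A_submod n).

Variable w : G -> R.

Definition Omega p : {pred chain R G p.+1} := fun v =>
  (v \in A p.+1) && (bd w v \in A p).

Arguments Omega : clear implicits.

Fact Omega_submod p : submod_closed (Omega p).
Proof.
split=> [|a u v /andP[u1 u2] /andP[v1 v2]].
  by apply/andP; rewrite linear0 !rpred0.
by apply/andP; rewrite linearP !rpredD ?rpredZ.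
Qed.
HB.instance Definition _ p :=
  GRing.isSubmodClosed.Build R (chain R G p.+1) (Omega p) (Omega_submod p).

Definition is_cycle p : {pred chain R G p.+1} := fun v =>
  (v \in Omega p) && (tbd w v == 0).

Arguments is_cycle : clear implicits.

Fact is_cycle_submod p : submod_closed (is_cycle p).
Proof.
split=> [|a u v /andP[u1 /eqP u2] /andP[v1 /eqP v2]].
  by apply/andP; rewrite linear0 rpred0.
by apply/andP; rewrite tbd_is_linear u2 v2 scaler0 addr0 rpredD ?rpredZ.
Qed.
HB.instance Definition _ p :=
  GRing.isSubmodClosed.Build R (chain R G p.+1) (is_cycle p) (is_cycle_submod p).

Record cycles p := Cycle {
  cycle_val :> chain R G p.+1;
  cycleP : cycle_val \in is_cycle p
}.
HB.instance Definition _ p := [isSub for @cycle_val p].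
HB.instance Definition _ p := [Choice of cycles p by <:].
HB.instance Definition _ p := [SubChoice_isSubLmodule of cycles p by <:].

Definition is_boundary p : {pred cycles p} := fun z =>
  `[< exists2 u : chain R G p.+2, u \in Omega p.+1 & bd w u = cycle_val z >].

Arguments is_boundary : clear implicits.

Fact is_boundary_submod p : submod_closed (is_boundary p).
Proof.
split=> [|a y z /asboolP[u uO uy] /asboolP[v vO vz]]; apply/asboolP.
  by exists 0; rewrite ?rpred0 // linear0.
exists (a *: u + v); first by rewrite rpredD ?rpredZ.
by rewrite bd_is_linear uy vz.
Qed.
HB.instance Definition _ p :=
  GRing.isSubmodClosed.Build R (cycles p) (is_boundary p) (is_boundary_submod p).

Definition homology p : Type := Quotient.quot (is_boundary p).
HB.instance Definition _ p := GRing.Zmodule.on (homology p).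

Definition hclass p (z : cycles p) : homology p :=
  \pi_(Quotient.quot (is_boundary p))%qT z.

Definition hscale p (a : R) (h : homology p) : homology p :=
  hclass (a *: (repr (h : Quotient.quot (is_boundary p)))).

Fact hclassD p : {morph @hclass p : y z / y + z}.
Proof. exact: (raddfD (\pi_(Quotient.quot (is_boundary p))%qT)). Qed.

Fact hclass_repr p (h : homology p) :
  hclass (repr (h : Quotient.quot (is_boundary p))) = h.
Proof. exact: reprK. Qed.

Fact hclass_eq p (y z : cycles p) :
  reflect (hclass y = hclass z) (y - z \in is_boundary p).
Proof. by rewrite (Quotient.idealrBE (is_boundary p)); apply: eqP. Qed.

Fact hclassZ p a (z : cycles p) : hclass (a *: z) = hscale a (hclass z).
Proof.
apply/hclass_eq; rewrite -scalerBr rpredZ //.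
by apply/hclass_eq; rewrite hclass_repr.
Qed.

Fact hscaleA p a b (h : homology p) : hscale a (hscale b h) = hscale (a * b) h.
Proof. by rewrite -[h]hclass_repr -!hclassZ scalerA. Qed.

Fact hscale1 p : left_id 1 (@hscale p).
Proof. by move=> h; rewrite -[h]hclass_repr -hclassZ scale1r. Qed.

Fact hscaleDr p : right_distributive (@hscale p) +%R.
Proof.
move=> a g h; rewrite -[g]hclass_repr -[h]hclass_repr.
by rewrite -hclassD -!hclassZ -hclassD scalerDr.
Qed.

Fact hscaleDl p (h : homology p) : {morph (@hscale p)^~ h : a b / a + b}.
Proof.
by move=> a b; rewrite -[h]hclass_repr -!hclassZ -hclassD scalerDl.
Qed.

HB.instance Definition _ p := GRing.Zmodule_isLmodule.Build R (homology p)
  (@hscaleA p) (@hscale1 p) (@hscaleDr p) (@hscaleDl p).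

End Homology.

Arguments homology {R} G w p.
Arguments cycles {R} G w p.
Arguments hclass {R G w p} z.

(* [phi] is the map induced in homology by the chain map [push f]; in
   particular [push f] sends cycles to cycles. *)
Definition induced_by (R : comPzRingType) (G G' : digraph)
    (w : G -> R) (w' : G' -> R) (f : G -> G') (p : nat)
    (phi : homology G w p -> homology G' w' p) : Prop :=
  forall z : cycles G w p, exists2 z' : cycles G' w' p,
    cycle_val z' = push f (cycle_val z) & phi (hclass z) = hclass z'.

(* Main.v *)
(** Write [m] for the map that applies [f] to every vertex of a path, so that
    [push f] is [reg] after [m].  Since [f] preserves the weights, [m] commutes
    with the boundary of Lambda, and it maps non-regular paths to non-regular
    paths.  The boundary of a path with [i_k = i_(k+1)] is non-regular: the terms
    that omit one of these two vertices cancel, their weights being equal, and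
    every other term keeps both.  Hence [push f] is a chain map.  It
    preserves allowed paths because an edge of [G] is mapped to an edge or to a
    single vertex, and in the latter case the image path is non-regular. *)
Require Import Defs.
From HB Require Import structures.
From mathcomp Require Import all_boot all_algebra generic_quotient ring_quotient.
From mathcomp Require Import boolp.

Set Implicit Arguments.
Unset Strict Implicit.
Unset Printing Implicit Defensive.

Import GRing.Theory.
Local Open Scope ring_scope.

(** * Linear maps determined by elementary paths *)

Section LinearExtension.
Variables (R : comPzRingType) (V : finType) (n : nat).

Lemma chain_sum (v : chain R V n) : v = \sum_t v t *: epath R t.
Proof.
apply/ffunP=> s; rewrite sum_ffunE (bigD1 s) //= big1 => [|t t_neq_s].
  by rewrite !ffunE eqxx addr0 [RHS]mulr1.
by rewrite !ffunE eq_sym (negPf t_neq_s) scaler0.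
Qed.

Lemma lext_epath (M : lmodType R) (g : n.-tuple V -> M) t :
  lext g (epath R t) = g t.
Proof.
rewrite /lext (bigD1 t) //= big1 => [|s s_neq_t].
  by rewrite ffunE eqxx scale1r addr0.
by rewrite ffunE (negPf s_neq_t) scale0r.
Qed.

Lemma eq_linear_epath (M : lmodType R) (g h : {linear chain R V n -> M}) :
  (forall t, g (epath R t) = h (epath R t)) -> g =1 h.
Proof.
move=> gh v; rewrite [v]chain_sum !linear_sum /=.
by apply: eq_bigr => t _; rewrite !linearZ /= gh.
Qed.

End LinearExtension.

(** * Non-regular paths and the boundary *)

Section Regularization.
Variables (R : comPzRingType) (V : finType).

Lemma reg_epath n (t : n.-tuple V) :
  reg (epath R t) = if regular t then epath R t else 0.
Proof. exact: lext_epath. Qed.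

Lemma nth_omit x0 n (t : n.+1.-tuple V) q i : (i < n)%N ->
  nth x0 (omit t q) i = nth x0 t (bump q i).
Proof.
move=> i_lt_n.
by rewrite -(tnth_nth x0 _ (Ordinal i_lt_n)) tnth_mktuple (tnth_nth x0).
Qed.

Lemma irregularP x0 n (t : n.-tuple V) :
  reflect (exists2 k, (k.+1 < n)%N & nth x0 t k = nth x0 t k.+1) (~~ regular t).
Proof.
apply: (iffP idP) => [irr_t | [k k_lt eq_k]].
  apply: contrapT => no_rep; case/negP: irr_t; apply/(sortedP x0) => i.
  by rewrite size_tuple => i_lt; apply/eqP => eq_i; apply: no_rep; exists i.
apply/negP => /(sortedP x0) /(_ k); rewrite size_tuple eq_k eqxx.
by move/(_ k_lt).
Qed.

(** The two omissions can differ only at position [a], where one reads entry [b] of [t] and the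
    other entry [a]. *)
Lemma omit_repeat x0 n (t : n.+1.-tuple V) (a b : 'I_n.+1) :
  b = a.+1 :> nat -> nth x0 t a = nth x0 t b -> omit t a = omit t b.
Proof.
move=> b_a eq_ab; apply: eq_from_tnth => i.
rewrite !(tnth_nth x0) !nth_omit // /bump b_a.
by case: (ltngtP a i) => [||<-] //; rewrite add1n -b_a.
Qed.

Lemma omit_irregular x0 n (t : n.+1.-tuple V) k (q : 'I_n.+1) :
    (k.+1 < n.+1)%N -> nth x0 t k = nth x0 t k.+1 ->
    q != k :> nat -> q != k.+1 :> nat ->
  ~~ regular (omit t q).
Proof.
move=> k_lt eq_k q_k q_k1; apply/(irregularP x0).
have q_lt := ltn_ord q.
case: (ltngtP q k) q_k => // q_vs_k _.
  (* Omitting [q] before the pair shifts it one place to the left, so the witness is the predecessor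
     of [k], which exists because [q < k]. *)
  case: k k_lt eq_k q_k1 q_vs_k => // k k_lt eq_k q_k1 q_vs_k.
  exists k => //; rewrite !nth_omit ?(ltnW (k_lt : (k.+1 < n)%N)) //.
  by rewrite /bump -ltnS q_vs_k (ltnW q_vs_k).
(* Here [q] lies beyond the pair, which keeps its place. *)
have k1_lt_q : (k.+1 < q)%N by rewrite ltn_neqAle eq_sym q_k1.
have k1_lt_n : (k.+1 < n)%N by apply: leq_trans k1_lt_q _; rewrite -ltnS.
exists k => //; rewrite !nth_omit ?(ltnW k1_lt_n) //.
by rewrite /bump leqNgt q_vs_k leqNgt k1_lt_q.
Qed.

Lemma bdLambda_epath (w : V -> R) n (t : n.+1.-tuple V) :
  bdLambda w (epath R t) =
  \sum_(q < n.+1) ((-1) ^+ q * w (tnth t q)) *: epath R (omit t q).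
Proof. exact: lext_epath. Qed.

Lemma bd_irregular (w : V -> R) n (t : n.+1.-tuple V) :
  ~~ regular t -> bd w (epath R t) = 0.
Proof.
(* [t] has at least one vertex, and the first one serves as the default for [nth]. *)
pose x0 := tnth t ord0; case/(irregularP x0) => k k1_lt eq_k.
pose a := Ordinal (ltnW k1_lt); pose b := Ordinal k1_lt.
rewrite /bd bdLambda_epath linear_sum (bigD1 a) //= (bigD1 b) /=; last first.
  by rewrite -val_eqE /= eqn_leq ltnn.
rewrite big1 => [|q /andP[q_a q_b]].
  rewrite (omit_repeat (a := a) (b := b) (erefl _) eq_k) addr0 -linearD -scalerDl.
  by rewrite !(tnth_nth x0) /= eq_k exprS mulN1r mulNr subrr scale0r linear0.
by rewrite linearZ /= reg_epath (negPf (omit_irregular k1_lt eq_k q_a q_b)) scaler0.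
Qed.

(** Non-regular paths have zero boundary, so [bd] descends to the quotient of Lambda by them. *)
Lemma bd_reg (w : V -> R) n (v : chain R V n.+1) : bd w (reg v) = bd w v.
Proof.
apply: (eq_linear_epath (g := bd w \o reg) (h := bd w)) => t /=.
by rewrite reg_epath; case: ifPn => // /bd_irregular ->; rewrite linear0.
Qed.

End Regularization.

(** * Compatibility of [push f] with the boundaries *)

Section ChainMap.
Variables (R : comPzRingType) (V V' : finType) (f : V -> V').

Definition mapLambda n : chain R V n -> chain R V' n :=
  lext (fun t => epath R (map_tuple f t)).
HB.instance Definition _ n := GRing.Linear.on (@mapLambda n).

Lemma mapLambda_epath n (t : n.-tuple V) :
  mapLambda (epath R t) = epath R (map_tuple f t).
Proof. exact: lext_epath. Qed.

Lemma push_epath n (t : n.-tuple V) :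
  push f (epath R t) = reg (epath R (map_tuple f t)).
Proof. exact: lext_epath. Qed.

Lemma pushE n (v : chain R V n) : push f v = reg (mapLambda v).
Proof.
apply: (eq_linear_epath (g := @push R V V' f n) (h := reg \o @mapLambda n)) => t /=.
by rewrite push_epath mapLambda_epath.
Qed.

Lemma map_irregular n (t : n.-tuple V) :
  ~~ regular t -> ~~ regular (map_tuple f t).
Proof.
apply: contra; rewrite /regular sorted_map; apply: sub_sorted => i j /=.
by apply: contra_neq => ->.
Qed.

Lemma push_reg n (v : chain R V n) : push f (reg v) = push f v.
Proof.
apply: (eq_linear_epath (g := @push R V V' f n \o reg) (h := @push R V V' f n)) => t /=.
rewrite reg_epath; case: ifPn => // /map_irregular irr_ft.
by rewrite linear0 push_epath reg_epath (negPf irr_ft).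
Qed.

Lemma map_omit n (t : n.+1.-tuple V) q :
  map_tuple f (omit t q) = omit (map_tuple f t) q.
Proof. by apply: eq_from_tnth => i; rewrite tnth_map !tnth_mktuple tnth_map. Qed.

Variables (w : V -> R) (w' : V' -> R).
Hypothesis wf : forall i, w i = w' (f i).

Lemma bdLambda_mapLambda n (v : chain R V n.+1) :
  bdLambda w' (mapLambda v) = mapLambda (bdLambda w v).
Proof.
apply: (eq_linear_epath (g := @bdLambda R V' w' n \o @mapLambda n.+1)
                        (h := @mapLambda n \o @bdLambda R V w n)) => t /=.
rewrite mapLambda_epath !bdLambda_epath linear_sum; apply: eq_bigr => q _.
by rewrite linearZ /= mapLambda_epath map_omit tnth_map wf.
Qed.

Lemma bd_push n (v : chain R V n.+1) : bd w' (push f v) = push f (bd w v).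
(* The intermediate [reg] is absorbed on each side: by the boundary on the left, by [push f] on the
   right. *)
Proof. by rewrite pushE bd_reg /bd bdLambda_mapLambda -pushE push_reg. Qed.

Lemma tbd_push p (v : chain R V p.+1) : tbd w' (push f v) = push f (tbd w v).
Proof. by case: p v => [|p] v /=; rewrite ?linear0 ?bd_push. Qed.

End ChainMap.

Lemma epath_A (R : comPzRingType) (G : digraph) n (t : n.-tuple G) :
  allowed t -> epath R t \in @A R G n.
Proof.
move=> t_allowed; apply/asboolP; exists (fun s => (s == t)%:R).
rewrite (bigD1 t) //= eqxx scale1r big1 ?addr0 // => s /andP[_ /negPf ->].
by rewrite scale0r.
Qed.

(** * From allowed chains to homology classes *)

Section Induced.
Variables (R : comPzRingType) (G G' : digraph) (w : G -> R) (w' : G' -> R).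
Variable f : wmorphism w w'.

Lemma push_A n (v : chain R G n) : v \in @A R G n -> push f v \in @A R G' n.
Proof.
case/asboolP=> c ->; rewrite linear_sum rpred_sum // => t t_allowed.
rewrite linearZ rpredZ //= push_epath reg_epath.
case: ifPn => [ft_regular|_]; last exact: rpred0.
apply: epath_A; move: t_allowed ft_regular.
rewrite /allowed /regular /= !sorted_map; case: t => -[|x s] _ //=.
(* Along the path, regularity of the image excludes [f x = f y], so each edge is mapped to an
   edge. *)
elim: s x => //= y s IHs x /andP[xy ys] /andP[fxy fys].
by rewrite IHs // andbT; case: (wmor_edge f xy) fxy => // ->; rewrite eqxx.
Qed.

Lemma push_Omega p (v : chain R G p.+1) :
  v \in @Omega R G w p -> push f v \in @Omega R G' w' p.
Proof.
case/andP=> vA dvA; apply/andP.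
by rewrite (bd_push (wmor_weight f)) !push_A.
Qed.

Lemma push_is_cycle p (z : cycles G w p) :
  push f (cycle_val z) \in @is_cycle R G' w' p.
Proof.
case: z => v /= /andP[vO /eqP dv0]; apply/andP; split; first exact: push_Omega.
by rewrite (tbd_push (wmor_weight f)) dv0 linear0.
Qed.

Definition push_cycle p (z : cycles G w p) : cycles G' w' p :=
  Cycle (push_is_cycle z).

Fact push_cycle_is_linear p : linear (@push_cycle p).
Proof. by move=> a y z; apply: val_inj; rewrite /= !linearP. Qed.
HB.instance Definition _ p :=
  GRing.isLinear.Build R (cycles G w p) (cycles G' w' p) *:%R (@push_cycle p)
    (@push_cycle_is_linear p).

Lemma push_boundary p (z : cycles G w p) :
  z \in @is_boundary R G w p -> push_cycle z \in @is_boundary R G' w' p.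
Proof.
case/asboolP=> u uO uz; apply/asboolP; exists (push f u); first exact: push_Omega.
by rewrite (bd_push (wmor_weight f)) uz.
Qed.

(** Computed on a chosen representative; [push_hclass] shows that the choice is immaterial. *)
Definition push_homology p (h : homology G w p) : homology G' w' p :=
  hclass (push_cycle (repr (h : Quotient.quot (@is_boundary R G w p)))).

(** The chosen representative differs from [z] by a boundary, and [push_cycle] is linear and
    preserves boundaries. *)
Lemma push_hclass p (z : cycles G w p) :
  push_homology (hclass z) = hclass (push_cycle z).
Proof.
apply/hclass_eq; rewrite -linearB; apply: push_boundary.
by apply/hclass_eq; rewrite hclass_repr.
Qed.

Fact push_homology_is_linear p : linear (@push_homology p).
Proof.
move=> a g h; rewrite -[g]hclass_repr -[h]hclass_repr.
(* [hclassZ] restated with the scaling of the module structure in place of [hscale]. *)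
have hZ (K : digraph) (u : K -> R) b (y : cycles K u p) :
  b *: hclass y = hclass (b *: y) by rewrite hclassZ.
by rewrite hZ -hclassD !push_hclass hZ linearP hclassD.
Qed.
HB.instance Definition _ p :=
  GRing.isLinear.Build R (homology G w p) (homology G' w' p) *:%R
    (@push_homology p) (@push_homology_is_linear p).

End Induced.

Theorem theorem3p6 (R : comPzRingType) (G G' : digraph)
    (w : G -> R) (w' : G' -> R)
    (hw : nonvanishing w) (hw' : nonvanishing w')
    (f : wmorphism w w') (p : nat) :
  exists phi : {linear homology G w p -> homology G' w' p},
    induced_by f phi.
Proof.
exists (@push_homology R G G' w w' f p) => z.
by exists (push_cycle f z); last exact: push_hclass.
Qed.
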